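(* Let $\{(g^\omega,p^\omega):\omega\in\Omega\}$ be a family of mechanisms such that for all $\omega$ and all inputs, $g^\omega_{ij}\in[0,1]$, $\sum_i g^\omega_{ij}\le1$, $p^\omega_i\ge0$ and $p^\omega_i(b,x,y)\le\sum_j g^\omega_{ij}(b,x,y)b_{ij}$; let $\mathcal U$ and $\mathcal P$ be the induced utility and payment classes. Assume every bidder's valuation satisfies $v_i(S)=\sum_{j\in S}v_{ij}\le1$ for all $S\subseteq[m]$. Let $(v^{(l)},x^{(l)},y^{(l)})$, $l=1,\dots,L$, be i.i.d. samples from the distribution $\mathbb P$ of $(v,x,y)$. Let $\delta\in(0,1)$ and let $\epsilon>0$ satisfy $$\epsilon\ge\sqrt{\frac{9n^2}{2L}\Big(\log\frac4\delta+\max\Big\{\log\mathcal N_{\infty,1}\big(\mathcal P,\tfrac\epsilon3\big),\log\mathcal N_{\infty,1}\big(\mathcal U,\tfrac\epsilon6\big)\Big\}\Big)}.$$ Then with probability at least $1-\delta$, simultaneously for all $\omega\in\Omega$, $$\Big|\mathbb E\Big[\sum_{i=1}^np_i^\omega(v,x,y)\Big]-\frac1L\sum_{l=1}^L\sum_{i=1}^np_i^\omega(v^{(l)},x^{(l)},y^{(l)})\Big|\le\epsilon$$ and $$\Big|\mathbb E\Big[\sum_{i=1}^n reg_i^\omega(v,x,y)\Big]-\sum_{i=1}^n\widehat{reg}_i(\omega)\Big|\le\epsilon .$$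
   Context: Setup: $n$ bidders, $m$ items, bidder contexts $x\in\mathcal X^n$, item contexts $y\in\mathcal Y^m$, valuation/bid matrices $v\in\mathcal V^{n\times m}$, $\mathcal V\subseteq\mathbb R_{\ge0}$; $(v_i',v_{-i})$ is $v$ with row $i$ replaced by $v_i'$. A mechanism $(g^\omega,p^\omega)$ has $g^\omega:\mathcal V^{n\times m}\times\mathcal X^n\times\mathcal Y^m\to\mathbb R^{n\times m}$ and $p^\omega:\mathcal V^{n\times m}\times\mathcal X^n\times\mathcal Y^m\to\mathbb R^n$; utility $u^\omega_i(v_i,b,x,y)=\sum_jg^\omega_{ij}(b,x,y)v_{ij}-p^\omega_i(b,x,y)$; ex-post regret $reg^\omega_i(v,x,y)=\max_{b_i'\in\mathcal V^m}u^\omega_i(v_i,(b_i',v_{-i}),x,y)-u^\omega_i(v_i,v,x,y)$; empirical regret $\widehat{reg}_i(\omega)=\frac1L\sum_{l=1}^L reg_i^\omega(v^{(l)},x^{(l)},y^{(l)})$. $\mathcal U=\{u^\omega:\omega\in\Omega\}$, $\mathcal P=\{p^\omega:\omega\in\Omega\}$. Distances: $l_{\infty,1}(p,p')=\sup_{(v,x,y)}\sum_i|p_i(v,x,y)-p'_i(v,x,y)|$, $l_{\infty,1}(u,u')=\sup_{(v,v',x,y)}\sum_i|u_i(v_i,(v_i',v_{-i}),x,y)-u'_i(v_i,(v_i',v_{-i}),x,y)|$. $\mathcal N_{\infty,1}(\mathcal F,r)$ is the minimum number of open $l_{\infty,1}$-balls of radius $r$ centered at elements of $\mathcal F$ needed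 to cover $\mathcal F$ (assumed finite). Maxima are assumed attained and all functions measurable. *)

(* Defs.v *)
From HB Require Import structures.
From mathcomp Require Import all_boot all_order all_algebra.
From mathcomp Require Import all_classical all_reals all_analysis.
Set Implicit Arguments. Unset Strict Implicit. Unset Printing Implicit Defensive.
Import Order.TTheory GRing.Theory Num.Theory.
Import numFieldNormedType.Exports.
Local Open Scope classical_set_scope.
Local Open Scope ring_scope.

Section Auction.
Variables (R : realType) (n m : nat) (X Y : Type).

Definition bidmat := 'M[R]_(n, m).
Definition bctx := 'I_n -> X.
Definition ictx := 'I_m -> Y.

Definition alloc_fun := bidmat -> bctx -> ictx -> 'M[R]_(n, m).
Definition pay_fun := bidmat -> bctx -> ictx -> 'I_n -> R.
Definition util_fun := 'I_n -> ('I_m -> R) -> bidmat -> bctx -> ictx -> R.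

Definition in_Vmat (V : set R) (b : bidmat) := forall i j, V (b i j).
Definition in_Vrow (V : set R) (r : 'I_m -> R) := forall j, V (r j).

Definition vrow (v : bidmat) (i : 'I_n) : 'I_m -> R := fun j => v i j.

Definition repl_row (v : bidmat) (i : 'I_n) (r : 'I_m -> R) : bidmat :=
  \matrix_(k, j) (if k == i then r j else v k j).

Definition utility (g : alloc_fun) (p : pay_fun) : util_fun :=
  fun i vi b x y => \sum_(j < m) g b x y i j * vi j - p b x y i.

(* ex-post regret; the maximum over b_i' in V^m (assumed attained) is
   written as the supremum *)
Definition regret (V : set R) (g : alloc_fun) (p : pay_fun)
    (v : bidmat) (x : bctx) (y : ictx) (i : 'I_n) : R :=
  sup [set utility g p i (vrow v i) (repl_row v i b') x y | b' in in_Vrow V]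
  - utility g p i (vrow v i) v x y.

Definition pay_dist (V : set R) (q q' : pay_fun) : \bar R :=
  ereal_sup [set z | exists v x y, in_Vmat V v /\
     z = (\sum_(i < n) `|q v x y i - q' v x y i|)%:E].

Definition util_dist (V : set R) (u u' : util_fun) : \bar R :=
  ereal_sup [set z | exists v v' x y, in_Vmat V v /\ in_Vmat V v' /\
     z = (\sum_(i < n) `|u i (vrow v i) (repl_row v i (vrow v' i)) x y
                          - u' i (vrow v i) (repl_row v i (vrow v' i)) x y|)%:E].

End Auction.

Definition covered_by {R : realType} {T : Type} (dist : T -> T -> \bar R)
    (F : set T) (r : R) (k : nat) :=
  exists c : 'I_k -> T, (forall i, F (c i)) /\
    forall f, F f -> exists i, (dist (c i) f < r%:E)%E.

Definition is_covering_number {R : realType} {T : Type}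
    (dist : T -> T -> \bar R) (F : set T) (r : R) (N : nat) :=
  covered_by dist F r N /\ forall k, covered_by dist F r k -> (N <= k)%N.

Definition iid_samples {R : realType} {dT dD : measure_display}
    {T : measurableType dT} {D : measurableType dD}
    (Q : probability T R) (P : probability D R) (L : nat)
    (S : 'I_L -> T -> D) :=
  (forall l, measurable_fun setT (S l)) /\
  forall A : 'I_L -> set D, (forall l, measurable (A l)) ->
    Q (\bigcap_(l in [set: 'I_L]) (S l @^-1` A l)) =
    (\prod_(l < L) P (A l))%E.

(* Main.v *)
(** Both [\sum_i p_i] and [\sum_i reg_i] take values in [[0, n]]: individual
    rationality bounds each payment by the total value [\sum_j v_ij <= 1] and
    makes the truthful utility nonnegative, while nonnegative payments bound
    each best-response utility by that same total value.

    Hoeffding's inequality at accuracy [eps / 3], with a union bound over the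
    centres of a finite cover, controls the deviations at the centres.  An [eps / 3]-cover of the payments is
    [eps / 3]-close in the summed payments; an [eps / 6]-cover of the utilities
    is [eps / 3]-close in the summed regrets, because the regret is a difference
    of two utilities and the best responses of the distinct bidders assemble
    into a single misreport matrix.  Passing from a mechanism to its centre
    costs [eps / 3] in the mean and [eps / 3] in the sample average. *)

Require Import Defs.
From HB Require Import structures.
From mathcomp Require Import all_boot all_order all_algebra.
From mathcomp Require Import all_classical all_reals all_analysis.
From mathcomp Require Import measurable_realfun ring lra.
Set Implicit Arguments. Unset Strict Implicit. Unset Printing Implicit Defensive.
Import Order.TTheory GRing.Theory Num.Theory.
Import numFieldNormedType.Exports.
Local Open Scope classical_set_scope.
Local Open Scope ring_scope.

(** * Exponential moments of a variable with values in [[0, 1]] *)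

(** Convexity of the exponential: its graph lies below the chord over the segment between [0] and
    [s]. *)
Lemma expR_chord (R : realType) (s f : R) : 0 <= f <= 1 ->
  expR (s * f) <= 1 - f + f * expR s.
Proof.
move=> /andP[f0 f1].
have := @convex_expR R (Itv01 f0 f1) s 0.
rewrite !convRE /= expR0 mulr1 mulr0 addr0 => h.
by rewrite mulrC (le_trans h)// /unstable.onem addrC.
Qed.

Lemma MVT_from0 (R : realType) (f df : R -> R) (s : R) :
  (forall x, is_derive x (1:R) f (df x)) -> 0 < s ->
  exists2 c, 0 < c & f s - f 0 = df c * s.
Proof.
move=> fdf s0.
have [|c] := @MVT R f df 0 s s0 (fun x _ => fdf x).
  apply: continuous_subspaceT => x.
  exact/differentiable_continuous/derivable1_diffP.
by rewrite in_itv/= subr0 => /andP[c0 _] h; exists c.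
Qed.

(* With [D x = 1 - mu + mu * exp x], the function
   [phi x = x^2/8 + x * mu - ln (D x)] satisfies [phi 0 = phi' 0 = 0] and
   [phi'' = 1/4 - q (1 - q) >= 0] for [q = mu * exp x / D x]. *)
Lemma hoeffding_mgf (R : realType) (mu s : R) : 0 <= mu <= 1 -> 0 <= s ->
  1 - mu + mu * expR s <= expR (s * mu + s ^+ 2 / 8).
Proof.
move=> /andP[mu0 mu1]; rewrite le0r => /predU1P[->|s0].
  by rewrite expR0 mulr1 subrK mul0r expr0n/= mul0r addr0 expR0.
pose D x : R := 1 - mu + mu * expR x.
have D0 x : 0 < D x.
  rewrite /D; have := expR_gt0 x; have [->|] := eqVneq mu 0.
    by rewrite mul0r; lra.
  move=> mun e0; have : 0 < mu * expR x by rewrite mulr_gt0// lt0r mun.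
  lra.
have dD x : is_derive x (1:R) D (mu * expR x).
  rewrite /D; apply: is_derive_eq; rewrite /GRing.scale/=; ring.
pose phi x : R := x ^+ 2 / 8 + x * mu - ln (D x).
pose dphi x : R := x / 4 + mu - 1 + (1 - mu) / D x.
have dphiP x : is_derive x (1:R) phi (dphi x).
  have dl : is_derive x (1:R) (@ln R \o D) ((D x)^-1 * (mu * expR x)).
    have ? := is_derive1_ln (D0 x); exact: is_derive1_comp.
  rewrite /phi; apply: is_derive_eq; rewrite /GRing.scale/= /dphi.
  rewrite (_ : mu * expR x = D x - (1 - mu)); last first.
    by rewrite /D [RHS]addrAC subrr add0r.
  field.
  by rewrite gt_eqF.
pose ddphi x : R := 4^-1 - (1 - mu) * (mu * expR x) / D x ^+ 2.
have ddphiP x : is_derive x (1:R) dphi (ddphi x).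
  have ? : D x != 0 by rewrite gt_eqF.
  rewrite /dphi; apply: is_derive_eq; rewrite /GRing.scale/= /ddphi.
  field.
  by rewrite gt_eqF.
have ddphi_ge0 x : 0 <= ddphi x.
  (* The square below equals [D x ^+ 2 - 4 * (1 - mu) * (mu * expR x)]. *)
  rewrite subr_ge0 ler_pdivrMr ?exprn_gt0// /D.
  have := sqr_ge0 (1 - mu - mu * expR x); nra.
have dphi0 : dphi 0 = 0.
  by rewrite /dphi /D expR0 mulr1 subrK; lra.
have phi0 : phi 0 = 0.
  by rewrite /phi /D expR0 mulr1 subrK ln1; lra.
(* Two mean value steps give [phi s = ddphi c' * c * s], a product of nonnegative factors. *)
have [c c0] := MVT_from0 dphiP s0; rewrite phi0 subr0.
have [c' _] := MVT_from0 ddphiP c0; rewrite dphi0 subr0 => -> h.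
have : 0 <= phi s by rewrite h !mulr_ge0// ltW.
rewrite subr_ge0 -ler_expR lnK ?qualifE/= ?D0// addrC.
by [].
Qed.

(** * Independence: from rectangles to products of functions *)

Import HBNNSimple.

(** The indicator hypothesis says that the measure with density [G], pushed forward along [phi], is
    [c * nu]. It passes to simple functions by linearity and to [F] by monotone convergence. *)
Lemma integral_weight_comp (R : realType) (d d' : measure_display)
  (T : measurableType d) (D : measurableType d')
  (mu : {measure set T -> \bar R}) (nu : {measure set D -> \bar R})
  (phi : T -> D) (G : T -> R) (c : R) (F : D -> R) :
  measurable_fun setT phi -> measurable_fun setT G -> (forall t, 0 <= G t) ->
  0 <= c ->
  (forall A, measurable A ->
    (\int[mu]_t (G t * \1_A (phi t))%:E = c%:E * nu A)%E) ->
  measurable_fun setT F -> (forall x, 0 <= F x) ->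
  (\int[mu]_t (G t * F (phi t))%:E = c%:E * \int[nu]_x (F x)%:E)%E.
Proof.
move=> mphi mG G0 c0 GA mF F0.
have mEF := (measurable_EFinP _ _).2 mF.
pose f := nnsfun_approx measurableT mEF.
have cvgf x : (EFin \o f ^~ x) @ \oo --> (F x)%:E.
  by apply: (cvg_nnsfun_approx measurableT mEF) => // y _; rewrite /= lee_fin.
have ndf x : {homo (fun n => f n x) : m n / (m <= n)%N >-> m <= n}.
  by move=> m n mn; exact/lefP/nd_nnsfun_approx.
transitivity (limn (fun n => \int[mu]_t (G t * f n (phi t))%:E)%E).
  rewrite -monotone_convergence//.
  - apply: eq_integral => t _; apply/esym/cvg_lim => //.
    under eq_fun do rewrite EFinM.
    by rewrite EFinM; apply: cvgeZl => //; exact: cvgf.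
  - move=> n; apply/measurable_EFinP/measurable_funM => //.
    exact: measurableT_comp.
  - by move=> n t _; rewrite lee_fin mulr_ge0.
  - by move=> t _ m n mn; rewrite lee_fin ler_wpM2l// ndf.
transitivity (limn (fun n => \int[nu]_x (c * f n x)%:E)%E); last first.
  rewrite -ge0_integralZl//; last by move=> x _; rewrite lee_fin.
  rewrite -monotone_convergence//.
  - apply: eq_integral => t _; apply/cvg_lim => //.
    under eq_fun do rewrite EFinM.
    by apply: cvgeZl => //; exact: cvgf.
  - by move=> n; apply/measurable_EFinP/measurable_funM.
  - by move=> n t _; rewrite lee_fin mulr_ge0.
  - by move=> t _ m n mn; rewrite lee_fin ler_wpM2l// ndf.
(* For a single simple function both integrals split over its level sets. *)
congr (limn _); apply/funext => n.
have m1 (r : R) : measurable (f n @^-1` [set r]) by exact: measurable_sfunP.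
transitivity (\sum_(r \in range (f n))
    \int[mu]_t (G t * (r * \1_(f n @^-1` [set r]) (phi t)))%:E)%E.
  rewrite -ge0_integral_fsum//.
  - apply: eq_integral => t _.
    by rewrite fimfunE mulr_fsumr -fsumEFin.
  - move=> r; apply/measurable_EFinP/measurable_funM => //.
    by apply: measurable_funM => //; exact: measurableT_comp.
  - move=> r t _; rewrite lee_fin mulr_ge0//.
    have := nnfun_muleindic_ge0 (f n) r (phi t); rewrite -EFinM lee_fin; exact.
transitivity (\sum_(r \in range (f n))
    \int[nu]_x (c * (r * \1_(f n @^-1` [set r]) x))%:E)%E; last first.
  rewrite -ge0_integral_fsum//.
  - apply: eq_integral => t _.
    by rewrite fimfunE mulr_fsumr -fsumEFin.
  - move=> r; apply/measurable_EFinP/measurable_funM => //.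
    by apply: measurable_funM.
  - move=> r t _; rewrite lee_fin mulr_ge0//.
    have := nnfun_muleindic_ge0 (f n) r t; rewrite -EFinM lee_fin; exact.
apply: eq_fsbigr => r /[!inE] -[x _ <-].
have fx0 : 0 <= f n x by [].
have mA := m1 (f n x).
under eq_integral do rewrite mulrCA EFinM.
rewrite ge0_integralZl//; first last.
- by move=> t _; rewrite lee_fin mulr_ge0.
- apply/measurable_EFinP/measurable_funM => //; exact: measurableT_comp.
rewrite GA//.
under [RHS]eq_integral do rewrite mulrCA EFinM EFinM.
rewrite ge0_integralZl//; first last.
- by move=> t _; rewrite mule_ge0// lee_fin.
- by apply/measurable_EFinP/measurable_funM.
rewrite ge0_integralZl//; first last.
- exact/measurable_EFinP/measurable_indic.
by rewrite integral_indic// setIT.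
Qed.

(* [iid_samples] only speaks of rectangles, i.e. of indicator functions; these
   are replaced one index at a time by arbitrary nonnegative functions. *)
Lemma iid_integral_prod (R : realType) (dT dD : measure_display)
  (T : measurableType dT) (D : measurableType dD)
  (Q : probability T R) (P : probability D R) (L : nat) (S : 'I_L -> T -> D)
  (F : 'I_L -> D -> R) (e : 'I_L -> R) :
  iid_samples Q P S ->
  (forall l, measurable_fun setT (F l)) -> (forall l x, 0 <= F l x) ->
  (forall l, \int[P]_x (F l x)%:E = (e l)%:E)%E ->
  (\int[Q]_t (\prod_(l < L) F l (S l t))%:E = (\prod_(l < L) e l)%:E)%E.
Proof.
move=> [mS indS].
(* Induction on [k], where the factors of index at least [k] are indicators; for [k = L] this
   condition is vacuous. *)
suff : forall (k : nat) (F : 'I_L -> D -> R) (e : 'I_L -> R),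
    (forall l, measurable_fun setT (F l)) -> (forall l x, 0 <= F l x) ->
    (forall l, \int[P]_x (F l x)%:E = (e l)%:E)%E ->
    (forall l : 'I_L, (k <= l)%N ->
      exists2 A, measurable A & F l = (\1_A : D -> R)) ->
    (\int[Q]_t (\prod_(l < L) F l (S l t))%:E = (\prod_(l < L) e l)%:E)%E.
  move=> H mF F0 Fe; apply: (H L) => // l; by rewrite leqNgt ltn_ord.
clear F e; elim=> [|k IH] F e mF F0 Fe Find.
  have {}Find l : {A | measurable A & F l = (\1_A : D -> R)}.
    by apply: cid2; exact: Find.
  pose A l := s2val (Find l).
  have mA l : measurable (A l) by exact: (s2valP (Find l)).
  have FA l : F l = \1_(A l) by exact: (s2valP' (Find l)).
  have eA l : (e l)%:E = P (A l).
    rewrite -Fe; under eq_integral do rewrite FA.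
    by rewrite integral_indic// setIT.
  rewrite -prodEFin; under [RHS]eq_bigr do rewrite eA.
  rewrite -indS//.
  set B := \bigcap_(l in _) _.
  have mB : measurable B.
    apply: fin_bigcap_measurable => // l _.
    by rewrite -[X in measurable X]setTI; exact: mS.
  rewrite -[X in Q X]setIT -integral_indic//; apply: eq_integral => t _.
  congr (_%:E); rewrite indicE; have [Bt|Bt] := pselect (B t).
    rewrite mem_set// big1// => l _; rewrite FA indicE mem_set//; exact: Bt.
  have [l lA] : exists l, ~ A l (S l t).
    by apply/existsNP => h; apply: Bt => l _; exact: h.
  by rewrite memNset// (bigD1 l)//= FA indicE memNset// mul0r.
have [kL|kL] := ltnP k L; last first.
  apply: IH => // l kl; apply: Find.
  by have := leq_trans kL kl; rewrite leqNgt ltn_ord.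
pose l0 := Ordinal kL.
under eq_integral do rewrite (bigD1 l0)//= mulrC.
rewrite (bigD1 l0)//= mulrC EFinM -Fe.
have e0 l : 0 <= e l.
  by rewrite -lee_fin -Fe integral_ge0// => x _; rewrite lee_fin.
(* The other factors form the weight and the product of their means the constant, so only an
   indicator at [l0] remains to be treated. *)
apply: (@integral_weight_comp R _ _ T D Q P (S l0)
  (fun t => \prod_(l < L | l != l0) F l (S l t))) => //.
- under eq_fun do rewrite -big_filter.
  by apply: measurable_prod => l _; exact: measurableT_comp.
- by move=> t; exact: prodr_ge0.
- exact: prodr_ge0.
move=> A mA.
(* With the indicator of [A] at [l0], every factor from index [k] on is an indicator, and the
   induction hypothesis applies. *)
pose F' l := if l == l0 then (\1_A : D -> R) else F l.
pose e' l := if l == l0 then fine (P A) else e l.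
have PA : (fine (P A))%:E = P A by rewrite fineK ?fin_num_measure.
have e'E : ((\prod_(l < L | l != l0) e l)%:E * P A = (\prod_(l < L) e' l)%:E)%E.
  rewrite [in RHS](bigD1 l0)//= {1}/e' eqxx mulrC EFinM PA; congr (_%:E * _)%E.
  by apply: eq_bigr => l ll0; rewrite /e' (negPf ll0).
rewrite e'E -(IH F').
- apply: eq_integral => t _; rewrite [in RHS](bigD1 l0)//= {1}/F' eqxx mulrC.
  congr (_ * _)%:E; apply: eq_bigr => l ll0; by rewrite /F' (negPf ll0).
- by move=> l; rewrite /F'; case: eqP.
- by move=> l x; rewrite /F'; case: eqP.
- move=> l; rewrite /F' /e'; case: eqP => // _.
  by rewrite integral_indic// setIT.
- move=> l kl; rewrite /F'; case: eqP => [_|/eqP ll0]; first by exists A.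
  apply: Find; rewrite ltn_neqAle kl andbT.
  by apply: contraNneq ll0 => kl'; apply/eqP/val_inj.
Qed.

(** * Hoeffding's inequality *)

Lemma measurable_superlevel (R : realType) (d : measure_display)
  (T : measurableType d) (h : T -> R) (a : R) :
  measurable_fun setT h -> measurable [set t | a <= h t].
Proof.
move=> mh; rewrite (_ : [set _ | _] = setT `&` h @^-1` `[a, +oo[%classic).
  exact: mh.
by rewrite setTI; apply/seteqP; split => t /=; rewrite in_itv/= andbT.
Qed.

Lemma measurable_empirical_mean (R : realType) (dT dD : measure_display)
  (T : measurableType dT) (D : measurableType dD) (L : nat) (S : 'I_L -> T -> D)
  (f : D -> R) :
  (forall l, measurable_fun setT (S l)) -> measurable_fun setT f ->
  measurable_fun setT (fun t => L%:R^-1 * \sum_(l < L) f (S l t)).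
Proof.
move=> mS mf; apply: measurable_funM => //.
by apply: measurable_sum => l; exact: measurableT_comp.
Qed.

(** Chernoff's method: on the event, the product over the samples of [exp (s * (f - mu - eps))] is
    at least 1. By independence its expectation is the [L]-th power of the one-sample expectation,
    which [expR_chord] and [hoeffding_mgf] bound. *)
Lemma hoeffding_upper01 (R : realType) (dT dD : measure_display)
  (T : measurableType dT) (D : measurableType dD)
  (Q : probability T R) (P : probability D R) (L : nat) (S : 'I_L -> T -> D)
  (f : D -> R) (mu eps : R) :
  iid_samples Q P S -> (0 < L)%N ->
  measurable_fun setT f -> (forall x, 0 <= f x <= 1) ->
  (\int[P]_x (f x)%:E = mu%:E)%E -> 0 <= eps ->
  (Q [set t | (eps <= L%:R^-1 * (\sum_(l < L) f (S l t)) - mu)%R]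
     <= (expR (- (2 * L%:R * eps ^+ 2)))%:E)%E.
Proof.
move=> iid L0 mf f01 fmu eps0.
have f0 x : 0 <= f x by have /andP[] := f01 x.
have mfE := (measurable_EFinP _ _).2 mf.
have mu01 : 0 <= mu <= 1.
  rewrite -!lee_fin -fmu integral_ge0/=; last by move=> x _; rewrite lee_fin.
  have -> : 1%E = (\int[P]_x (cst 1%E x))%E :> \bar R.
    by rewrite integral_cst//= mul1e probability_setT.
  by apply: ge0_le_integral => // x _; rewrite lee_fin//; have /andP[] := f01 x.
have L0R : 0 < L%:R :> R by rewrite ltr0n.
(* [s = 4 * eps] minimises [s^2/8 - s * eps]. *)
pose s := 4 * eps; have s0 : 0 <= s by rewrite mulr_ge0.
pose F x := expR (s * f x) * expR (- (s * (mu + eps))).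
have F0 x : 0 <= F x by rewrite mulr_ge0// expR_ge0.
have mF : measurable_fun setT F.
  apply: measurable_funM => //; apply: measurableT_comp => //.
  exact: measurable_funM.
have intF : (\int[P]_x (F x)%:E <= (expR (- (2 * eps ^+ 2)))%:E)%E.
  pose K := expR (- (s * (mu + eps))).
  have K0 : 0 <= K by exact: expR_ge0.
  have es0 : 0 <= expR s - 1 by rewrite subr_ge0 -expR0 ler_expR.
  (* The chord bound makes the integrand affine in [f], so that only the mean [mu] enters. *)
  apply: (@le_trans _ _
      (\int[P]_x (K%:E + (K * (expR s - 1))%:E * (f x)%:E))%E).
    apply: ge0_le_integral => //.
    - by move=> x _; rewrite lee_fin.
    - exact/measurable_EFinP.
    - by apply: emeasurable_funD => //; exact: emeasurable_funM.
    - move=> x _; rewrite -EFinM -EFinD lee_fin /F -/K mulrC.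
      have /(ler_wpM2l K0) := expR_chord s (f01 x); lra.
  rewrite ge0_integralD//; first last.
  - exact: emeasurable_funM.
  - by move=> x _; rewrite mule_ge0// lee_fin// mulr_ge0.
  rewrite integral_cst//= probability_setT mule1.
  rewrite ge0_integralZl//; last 2 first.
  - by move=> x _; rewrite lee_fin.
  - by rewrite lee_fin mulr_ge0.
  rewrite fmu -EFinM -EFinD lee_fin.
  have := hoeffding_mgf mu01 s0.
  move/(ler_wpM2l K0); rewrite -expRD => h.
  apply: le_trans (le_trans _ h) _; first lra.
  rewrite ler_expR /s; lra.
set e := (\int[P]_x (F x)%:E)%E in intF.
have e0 : (0 <= e)%E by apply: integral_ge0 => x _; rewrite lee_fin.
have efin : e = (fine e)%:E.
  by rewrite fineK// ge0_fin_numE// (le_lt_trans intF)// ltry.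
have := @iid_integral_prod R _ _ T D Q P L S (fun=> F) (fun=> fine e) iid
  (fun=> mF) (fun=> F0) (fun=> efin).
rewrite prodr_const card_ord => intQ.
have mS l : measurable_fun setT (S l) by case: iid.
set A := [set t | _].
have mA : measurable A.
  apply: measurable_superlevel; apply: measurable_funB => //.
  exact: measurable_empirical_mean.
apply: (@le_trans _ _ ((fine e) ^+ L)%:E); last first.
  rewrite (_ : - _ = L%:R * - (2 * eps ^+ 2)); last by ring.
  rewrite lee_fin expRM_natl ler_pXn2r// ?nnegrE ?fine_ge0 ?expR_ge0//.
  by rewrite -lee_fin -efin.
(* Markov's inequality, by comparing the indicator of [A] pointwise with the product. *)
rewrite -intQ -[X in Q X]setIT -integral_indic//.
apply: ge0_le_integral => //.
- exact/measurable_EFinP/measurable_indic.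
- apply/measurable_EFinP; apply: measurable_prod => l _.
  exact: measurableT_comp.
move=> t _; rewrite lee_fin indicE; case: (boolP (t \in A)) => [|_]; last first.
  by rewrite prodr_ge0.
rewrite inE => At.
have -> : \prod_(l < L) F (S l t) =
    expR (\sum_(l < L) (s * f (S l t) - s * (mu + eps))).
  by rewrite expR_sum; apply: eq_bigr => l _; rewrite /F expRD.
rewrite -expR0 ler_expR sumrB -mulr_sumr sumr_const card_ord -mulrnAr -mulrBr.
rewrite mulr_ge0//.
rewrite subr_ge0 -[X in X <= _]mulr_natl -ler_pdivlMl//.
by move: At; rewrite /A/= lerBrDl.
Qed.

(** The one-sided bound at threshold [eps / c] is applied to [f / c] for the upper tail and to
    [1 - f / c] for the lower one. *)
Lemma hoeffding (R : realType) (dT dD : measure_display)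
  (T : measurableType dT) (D : measurableType dD)
  (Q : probability T R) (P : probability D R) (L : nat) (S : 'I_L -> T -> D)
  (f : D -> R) (c mu eps : R) :
  iid_samples Q P S -> (0 < L)%N -> 0 < c ->
  measurable_fun setT f -> (forall x, 0 <= f x <= c) ->
  (\int[P]_x (f x)%:E = mu%:E)%E -> 0 <= eps ->
  (Q [set t | (eps <= `|mu - L%:R^-1 * \sum_(l < L) f (S l t)|)%R]
     <= (2 * expR (- (2 * L%:R * (eps / c) ^+ 2)))%:E)%E.
Proof.
move=> iid L0 c0 mf f0c fmu eps0.
have f0 x : 0 <= f x by have /andP[] := f0c x.
have mS l : measurable_fun setT (S l) by case: iid.
have mfE := (measurable_EFinP _ _).2 mf.
have ci0 : 0 <= c^-1 by rewrite invr_ge0 ltW.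
pose g x := c^-1 * f x.
have g01 x : 0 <= g x <= 1.
  have /andP[h0 h1] := f0c x; apply/andP; split; first exact: mulr_ge0.
  by rewrite /g ler_pdivrMl// mulr1.
have mg : measurable_fun setT g by exact: measurable_funM.
have intg : (\int[P]_x (g x)%:E = (c^-1 * mu)%:E)%E.
  under eq_integral do rewrite EFinM.
  by rewrite ge0_integralZl// ?fmu// => x _; rewrite lee_fin.
pose k x := 1 - g x.
have k01 x : 0 <= k x <= 1 by have /andP[? ?] := g01 x; rewrite /k; lra.
have mk : measurable_fun setT k by exact: measurable_funB.
have intk : (\int[P]_x (k x)%:E = (1 - c^-1 * mu)%:E)%E.
  rewrite EFinB -intg.
  have -> : 1%:E = (\int[P]_x (g x + k x)%:E)%E :> \bar R.
    under eq_integral do rewrite /k addrC subrK.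
    by rewrite integral_cst//= mul1e probability_setT.
  under [in RHS]eq_integral do rewrite EFinD.
  rewrite ge0_integralD//; last 4 first.
  - by move=> x _; rewrite lee_fin; case/andP: (g01 x).
  - exact/measurable_EFinP.
  - by move=> x _; rewrite lee_fin; case/andP: (k01 x).
  - exact/measurable_EFinP.
  by rewrite addeAC intg -EFinB subrr add0e.
have ec0 : 0 <= eps / c by rewrite mulr_ge0.
have hg := hoeffding_upper01 iid L0 mg g01 intg ec0.
have hk := hoeffding_upper01 iid L0 mk k01 intk ec0.
set A1 := [set t | _] in hg; set A2 := [set t | _] in hk.
have mA1 : measurable A1.
  apply: measurable_superlevel; apply: measurable_funB => //.
  exact: measurable_empirical_mean.
have mA2 : measurable A2.
  apply: measurable_superlevel; apply: measurable_funB => //.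
  exact: measurable_empirical_mean.
rewrite mulrDl mul1r EFinD; apply: le_trans (leeD hg hk).
apply: le_trans (measureU2 _ mA1 mA2).
apply: le_measure; rewrite ?inE.
- apply: measurable_superlevel; apply: measurableT_comp => //.
  by apply: measurable_funB => //; exact: measurable_empirical_mean.
- exact: measurableU.
move=> t /=; set E := L%:R^-1 * _.
have L0R : L%:R != 0 :> R by rewrite pnatr_eq0 -lt0n.
have Eg : L%:R^-1 * \sum_(l < L) g (S l t) = c^-1 * E.
  by rewrite -mulr_sumr mulrCA.
have Ek : L%:R^-1 * \sum_(l < L) k (S l t) = 1 - c^-1 * E.
  by rewrite sumrB mulrBr Eg sumr_const card_ord mulVf.
rewrite /A1 /A2 /= Eg Ek ![eps / c]mulrC.
rewrite ler_normr => /orP[h|h]; [right|left] => /=.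
  rewrite (_ : _ - _ = c^-1 * (mu - E)); last by ring.
  exact: ler_wpM2l.
rewrite -mulrBr; apply: ler_wpM2l => //; by rewrite -opprB.
Qed.

(** * Uniform deviation over a finite cover *)

(** The existence is informative, so that a real mean can be selected for every member of a
    family. *)
Lemma mean_exists (R : realType) (d : measure_display)
  (D : measurableType d) (P : probability D R) (c : R) (f : D -> R) :
  measurable_fun setT f -> (forall x, 0 <= f x <= c) ->
  {mu | (\int[P]_x (f x)%:E = mu%:E)%E}.
Proof.
move=> mf f0c; exists (fine (\int[P]_x (f x)%:E)%E).
rewrite fineK// ge0_fin_numE; last first.
  by apply: integral_ge0 => x _; rewrite lee_fin; case/andP: (f0c x).
apply: (@le_lt_trans _ _ (\int[P]_x (cst c%:E x))%E).
  apply: ge0_le_integral => //.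
  - by move=> x _; rewrite lee_fin; case/andP: (f0c x).
  - exact/measurable_EFinP.
  - by move=> x _; rewrite lee_fin; case/andP: (f0c x).
by rewrite integral_cst//= probability_setT mule1 ltry.
Qed.

(** One-sided and for nonnegative functions, so that additivity and monotonicity of nonnegative
    integrals suffice; two uses bound the distance between two means. *)
Lemma mean_le_add (R : realType) (d : measure_display)
  (D : measurableType d) (P : probability D R) (f g : D -> R) (r a b : R) :
  measurable_fun setT f -> measurable_fun setT g ->
  (forall x, 0 <= f x) -> (forall x, 0 <= g x) -> 0 <= r ->
  (forall x, f x <= g x + r) ->
  (\int[P]_x (f x)%:E = a%:E)%E -> (\int[P]_x (g x)%:E = b%:E)%E ->
  a <= b + r.
Proof.
move=> mf mg f0 g0 r0 fg fa gb.
have mf' := (measurable_EFinP _ _).2 mf.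
have mg' := (measurable_EFinP _ _).2 mg.
have : (\int[P]_x (f x)%:E <= \int[P]_x ((g x)%:E + cst r%:E x))%E.
  apply: ge0_le_integral => //.
  - by move=> x _; rewrite lee_fin.
  - exact: emeasurable_funD.
  - by move=> x _; rewrite -EFinD lee_fin.
rewrite ge0_integralD//; last by move=> x _; rewrite lee_fin.
by rewrite integral_cst//= probability_setT mule1 fa gb -EFinD lee_fin.
Qed.

(** The bad event involves the finitely many centres only, which keeps [G] measurable for an
    arbitrary index type [W]. The bound [3 * r] collects the deviation at the centre and the two
    costs of moving to it. *)
Lemma uniform_deviation (R : realType) (dT dD : measure_display)
  (T : measurableType dT) (D : measurableType dD)
  (Q : probability T R) (P : probability D R) (L : nat) (S : 'I_L -> T -> D)
  (W : Type) (H : W -> D -> R) (N : nat) (ctr : 'I_N -> W) (c r : R) :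
  iid_samples Q P S -> (0 < L)%N -> 0 < c -> 0 <= r ->
  (forall w, measurable_fun setT (H w)) -> (forall w x, 0 <= H w x <= c) ->
  (forall w, exists i, forall x, `|H (ctr i) x - H w x| <= r) ->
  exists G : set T, [/\ measurable G,
    (Q (~` G) <= (N%:R * (2 * expR (- (2 * L%:R * (r / c) ^+ 2))))%:E)%E &
    forall t, G t -> forall w,
      (`| (\int[P]_x (H w x)%:E)
          - (L%:R^-1 * \sum_(l < L) H w (S l t))%:E | <= (3 * r)%:E)%E].
Proof.
move=> iid L0 c0 r0 mH H0c; case: N ctr => [|N] ctr cov.
  (* Without centres the covering hypothesis makes [W] empty. *)
  exists setT; split => //; first by rewrite setCT measure0 mul0r.
  by move=> t _ w; case: (cov w) => -[].
have mS l : measurable_fun setT (S l) by case: iid.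
have H0 w x : 0 <= H w x by case/andP: (H0c w x).
pose mean w := projT1 (mean_exists P (mH w) (H0c w)).
have meanE w : (\int[P]_x (H w x)%:E = (mean w)%:E)%E.
  exact: (projT2 (mean_exists P (mH w) (H0c w))).
pose emp w t := L%:R^-1 * \sum_(l < L) H w (S l t).
(* Events are indexed by [nat] for Boole's inequality; below [N.+1] the map [inord] recovers the
   index of the centre. *)
pose B n := [set t | r <= `|mean (ctr (inord n)) - emp (ctr (inord n)) t|].
have mB n : measurable (B n).
  apply: measurable_superlevel; apply: measurableT_comp => //.
  by apply: measurable_funB => //; exact: measurable_empirical_mean.
have mU : measurable (\big[setU/set0]_(i < N.+1) B i).
  exact: bigsetU_measurable.
exists (~` \big[setU/set0]_(i < N.+1) B i); split.
- exact: measurableC.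
- rewrite setCK; apply: (le_trans (Boole_inequality _ _)) => //.
  apply: (@le_trans _ _ (\sum_(i < N.+1)
      (2 * expR (- (2 * L%:R * (r / c) ^+ 2)))%:E)%E).
    by apply: lee_sum => i _; apply: hoeffding (meanE _) r0.
  by rewrite sumEFin sumr_const card_ord (mulr_natl _ N.+1).
move=> t Gt w; rewrite meanE -EFinB/= lee_fin.
have [i icov] := cov w.
have dev : `|mean (ctr i) - emp (ctr i) t| < r.
  rewrite ltNge; apply/negP => h; apply: Gt.
  by rewrite -bigcup_mkord; exists (i : nat) => //=; rewrite /B/= inord_val.
have meandev : `|mean w - mean (ctr i)| <= r.
  have h1 : mean (ctr i) <= mean w + r.
    apply: (mean_le_add (mH _) (mH _) (H0 _) (H0 _) r0 _
      (meanE _) (meanE _)) => x.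
    by have := icov x; rewrite ler_norml; lra.
  have h2 : mean w <= mean (ctr i) + r.
    apply: (mean_le_add (mH _) (mH _) (H0 _) (H0 _) r0 _
      (meanE _) (meanE _)) => x.
    by have := icov x; rewrite ler_norml; lra.
  by rewrite ler_norml; lra.
have empdev : `|emp (ctr i) t - emp w t| <= r.
  rewrite /emp -mulrBr -sumrB normrM ger0_norm ?invr_ge0//.
  rewrite ler_pdivrMl ?ltr0n// (le_trans (ler_norm_sum _ _ _))//.
  rewrite (@le_trans _ _ (\sum_(l < L) r))//; first exact: ler_sum.
  by rewrite sumr_const card_ord mulr_natl.
rewrite -/(emp w t).
have -> : mean w - emp w t = (mean w - mean (ctr i)) +
   (mean (ctr i) - emp (ctr i) t) + (emp (ctr i) t - emp w t) by ring.
rewrite (le_trans (ler_normD _ _))// (_ : 3 * r = r + r + r); last by ring.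
by rewrite lerD// (le_trans (ler_normD _ _))// lerD// ltW.
Qed.

(** Inverts the sample size condition: it bounds [ln (4 / delta * N)] by the Hoeffding exponent at
    accuracy [eps / 3] and range [n]. The slack [B] lets one maximum serve both covering numbers. *)
Lemma covering_tail_le (R : realType) (n L N : nat) (B delta eps : R) :
  (0 < n)%N -> (0 < L)%N -> 0 < delta < 1 -> 0 < eps -> ln N%:R <= B ->
  Num.sqrt ((9 * n%:R ^+ 2) / (2 * L%:R) * (ln (4 / delta) + B)) <= eps ->
  N%:R * (2 * expR (- (2 * L%:R * (eps / 3 / n%:R) ^+ 2))) <= delta / 2.
Proof.
move=> n0 L0 /andP[d0 d1] e0.
case: N => [|N] NB hs; first by rewrite mul0r divr_ge0 ?ltW.
have nR : 0 < n%:R :> R by rewrite ltr0n.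
have LR : 0 < L%:R :> R by rewrite ltr0n.
have {hs} : Num.sqrt ((9 * n%:R ^+ 2) / (2 * L%:R) *
    (ln (4 / delta) + ln N.+1%:R)) <= eps.
  apply: le_trans hs; apply: ler_wsqrtr; apply: ler_wpM2l.
    by rewrite divr_ge0// mulr_ge0// sqr_ge0.
  by rewrite lerD2l.
have NR : 0 < N.+1%:R :> R by [].
have d4 : 0 < 4 / delta by rewrite divr_gt0.
have prod0 : 0 < 4 / delta * N.+1%:R by rewrite mulr_gt0.
rewrite -lnM ?posrE// => hs.
have ln0 : 0 <= ln (4 / delta * N.+1%:R).
  rewrite ln_ge0// mulrAC ler_pdivlMr// mul1r.
  have : 1 <= N.+1%:R :> R by rewrite ler1n.
  lra.
have {}hs : (9 * n%:R ^+ 2) / (2 * L%:R) * ln (4 / delta * N.+1%:R) <= eps ^+ 2.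
  rewrite -(@ler_sqrt _ _ (eps ^+ 2)) ?sqr_ge0//.
  by rewrite sqrtr_sqr gtr0_norm.
have {}hs : ln (4 / delta * N.+1%:R) <= 2 * L%:R * (eps / 3 / n%:R) ^+ 2.
  have -> : 2 * L%:R * (eps / 3 / n%:R) ^+ 2 =
    ((9 * n%:R ^+ 2) / (2 * L%:R))^-1 * eps ^+ 2.
    by field; rewrite !gt_eqF.
  by rewrite ler_pdivlMl// divr_gt0// mulr_gt0// exprn_gt0.
have {hs} : expR (- (2 * L%:R * (eps / 3 / n%:R) ^+ 2)) <=
    (4 / delta * N.+1%:R)^-1.
  rewrite -[X in _ <= X](lnK _) ?posrE ?invr_gt0// lnV ?posrE//.
  by rewrite ler_expR lerN2.
move=> hE.
(* In [4 / delta], one factor 2 absorbs the two tails, and the other leaves [delta / 2] for each of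
   the two classes. *)
apply: (@le_trans _ _ (N.+1%:R * (2 * (4 / delta * N.+1%:R)^-1))).
  by apply: ler_wpM2l => //; rewrite ler_wpM2l.
rewrite le_eqVlt; apply/orP; left; apply/eqP; field.
by rewrite !gt_eqF.
Qed.

(** * Bounds and stability of the regret *)

Section regret.
Context (R : realType) (n m : nat) (X Y : Type) (V : set R).
Implicit Types (g : alloc_fun R n m X Y) (p : pay_fun R n m X Y).

Lemma repl_row_id (v : 'M[R]_(n, m)) i : repl_row v i (vrow v i) = v.
Proof. by apply/matrixP => k j; rewrite mxE; case: eqP => [->|]. Qed.

Lemma in_Vmat_repl_row (v : 'M[R]_(n, m)) i r :
  in_Vmat V v -> in_Vrow V r -> in_Vmat V (repl_row v i r).
Proof. by move=> vV rV k j; rewrite mxE; case: ifP. Qed.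

(** Names the maximiser given by the attainment hypothesis, through which the supremum in [regret]
    becomes a utility value. *)
Definition best_response g p (v : 'M[R]_(n, m)) x y i (b : 'I_m -> R) :=
  in_Vrow V b /\ forall b', in_Vrow V b' ->
    utility g p i (vrow v i) (repl_row v i b') x y
    <= utility g p i (vrow v i) (repl_row v i b) x y.

Lemma regret_best_response g p v x y i b : best_response g p v x y i b ->
  regret V g p v x y i =
    utility g p i (vrow v i) (repl_row v i b) x y
    - utility g p i (vrow v i) v x y.
Proof.
move=> [bV bmax]; rewrite /regret; congr (_ - _).
set u := utility g p i _ (repl_row v i b) x y; set A := [set _ | _ in _].
have Ab : A u by exists b.
have ubA : ubound A u.
  by move=> _ [b' b'V <-]; exact: bmax.
apply/le_anti/andP; split; first by apply: ge_sup => //; exists u.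
by apply: ub_le_sup => //; exists u.
Qed.

Lemma regret_ge0 g p v x y i b : in_Vmat V v -> best_response g p v x y i b ->
  0 <= regret V g p v x y i.
Proof.
move=> vV br; rewrite (regret_best_response br) subr_ge0.
case: br => _ bmax; rewrite -{2}(repl_row_id v i).
by apply: bmax => j; exact: vV.
Qed.

Lemma utility_le g p (v : 'M[R]_(n, m)) i b x y :
  (forall j, 0 <= g b x y i j <= 1) -> 0 <= p b x y i ->
  (forall j, 0 <= v i j) ->
  utility g p i (vrow v i) b x y <= \sum_(j < m) v i j.
Proof.
move=> g01 p0 v0; rewrite /utility lerBlDr ler_wpDr//.
apply: ler_sum => j _; have /andP[_ g1] := g01 j.
by rewrite /vrow ler_piMl.
Qed.

Lemma regret_le g p (v : 'M[R]_(n, m)) x y i b :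
  (forall b, in_Vmat V b -> forall i j, 0 <= g b x y i j <= 1) ->
  (forall b, in_Vmat V b -> forall i, 0 <= p b x y i) ->
  p v x y i <= \sum_(j < m) g v x y i j * v i j ->
  (forall r, V r -> 0 <= r) ->
  in_Vmat V v -> best_response g p v x y i b ->
  regret V g p v x y i <= \sum_(j < m) v i j.
Proof.
move=> g01 p0 pv V0 vV br; rewrite (regret_best_response br).
have bV := in_Vmat_repl_row i vV (proj1 br).
rewrite lerBlDr ler_wpDr//; first by rewrite /utility subr_ge0.
apply: utility_le; [exact: g01|exact: p0|by move=> j; exact: V0].
Qed.

(** A single misreport [r] serves both mechanisms: it is the best response of the one with the
    larger regret, since the other mechanism's optimum is at least its utility at [r]. *)
Lemma regret_diff_le g p g' p' v x y i b b' :
  best_response g p v x y i b -> best_response g' p' v x y i b' ->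
  exists2 r, in_Vrow V r &
  `|regret V g p v x y i - regret V g' p' v x y i| <=
    `|utility g p i (vrow v i) (repl_row v i r) x y
      - utility g' p' i (vrow v i) (repl_row v i r) x y| +
    `|utility g p i (vrow v i) v x y - utility g' p' i (vrow v i) v x y|.
Proof.
move=> br br'.
rewrite (regret_best_response br).
rewrite (regret_best_response br').
case: br br' => bV bmax [b'V b'max].
have := bmax _ b'V; have := b'max _ bV.
set ub := utility g p i _ (repl_row v i b) x y.
set ub' := utility g p i _ (repl_row v i b') x y.
set wb := utility g' p' i _ (repl_row v i b) x y.
set wb' := utility g' p' i _ (repl_row v i b') x y.
set u := utility g p i _ v x y; set w := utility g' p' i _ v x y.
move=> h1 h2.
have n1 := ler_norm (u - w); have n2 := ler_norm (w - u).
rewrite distrC in n2.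
(* The sign of the regret difference [(ub - wb') - (u - w)] decides which best response to take. *)
have [h|h] := leP (u - w) (ub - wb').
- exists b => //; rewrite -/ub -/wb.
  have n3 := ler_norm (ub - wb); have n4 := ler_norm (wb - ub).
  rewrite ler_norml; apply/andP; split; lra.
- exists b' => //; rewrite -/ub' -/wb'.
  have n3 := ler_norm (wb' - ub'); rewrite distrC in n3.
  rewrite ler_norml; apply/andP; split; lra.
Qed.

End regret.

(** * Transfer of the covers to payments and regrets, and the final union bound *)

Theorem theorem4 (R : realType) (n m L : nat) (X Y : Type) (V : set R)
  (Om : Type) (g : Om -> alloc_fun R n m X Y) (p : Om -> pay_fun R n m X Y)
  (dD : measure_display) (D : measurableType dD) (P : probability D R)
  (vD : D -> 'M[R]_(n, m)) (xD : D -> 'I_n -> X) (yD : D -> 'I_m -> Y)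
  (dT : measure_display) (T : measurableType dT) (Q : probability T R)
  (S : 'I_L -> T -> D) (delta eps : R) (NP NU : nat) :
  (* valuation set V is a subset of R_{>=0} *)
  (forall r, V r -> 0 <= r) ->
  (* constraints on the mechanisms, for all omega and all inputs *)
  (forall w b x y, in_Vmat V b -> forall i j, 0 <= g w b x y i j <= 1) ->
  (forall w b x y, in_Vmat V b -> forall j, \sum_(i < n) g w b x y i j <= 1) ->
  (forall w b x y, in_Vmat V b -> forall i, 0 <= p w b x y i) ->
  (forall w b x y, in_Vmat V b ->
     forall i, p w b x y i <= \sum_(j < m) g w b x y i j * b i j) ->
  (* maxima in the definition of the regret are attained *)
  (forall w v x y i, in_Vmat V v ->
     exists2 b', in_Vrow V b' & forall b'', in_Vrow V b'' ->
       utility (g w) (p w) i (vrow v i) (repl_row v i b'') x y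
       <= utility (g w) (p w) i (vrow v i) (repl_row v i b') x y) ->
  (* the random data point (v,x,y) ~ P: v in V^{n x m}, additive with v_i([m]-subsets) <= 1 *)
  (forall d, in_Vmat V (vD d)) ->
  (forall d i (A : {set 'I_m}), \sum_(j in A) vD d i j <= 1) ->
  (* measurability of the relevant functions *)
  (forall w, measurable_fun setT
     (fun d => \sum_(i < n) p w (vD d) (xD d) (yD d) i)) ->
  (forall w, measurable_fun setT
     (fun d => \sum_(i < n) regret V (g w) (p w) (vD d) (xD d) (yD d) i)) ->
  (* i.i.d. samples from P *)
  (0 < L)%N ->
  iid_samples Q P S ->
  (* covering numbers of the payment and utility classes *)
  is_covering_number (pay_dist V) (range p) (eps / 3) NP ->
  is_covering_number (util_dist V)
    (range (fun w => utility (g w) (p w))) (eps / 6) NU ->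
  0 < delta < 1 -> 0 < eps ->
  Num.sqrt ((9 * n%:R ^+ 2) / (2 * L%:R) *
            (ln (4 / delta) + Num.max (ln NP%:R) (ln NU%:R))) <= eps ->
  exists G : set T, [/\ measurable G, ((1 - delta)%:E <= Q G)%E &
    forall t, G t -> forall w,
      (`| (\int[P]_d (\sum_(i < n) p w (vD d) (xD d) (yD d) i)%:E)
          - (L%:R^-1 * \sum_(l < L) \sum_(i < n)
               p w (vD (S l t)) (xD (S l t)) (yD (S l t)) i)%:E | <= eps%:E)%E
      /\
      (`| (\int[P]_d (\sum_(i < n) regret V (g w) (p w) (vD d) (xD d) (yD d) i)%:E)
          - (\sum_(i < n) (L%:R^-1 * \sum_(l < L)
               regret V (g w) (p w) (vD (S l t)) (xD (S l t)) (yD (S l t)) i))%:E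
        | <= eps%:E)%E].
Proof.
move=> V0 g01 gsum p0 pIR attained vV vsum mP mR L0 iid covP covU d01 eps0 heps.
(* Without bidders all sums vanish; otherwise the range [n] is positive, as [uniform_deviation]
   requires. *)
have [n0|n0] := posnP n.
  have z (F : 'I_n -> R) : \sum_(i < n) F i = 0.
    by apply: big1 => i _; have := ltn_ord i; rewrite [X in (_ < X)%N]n0.
  have eps0' : (0%E <= eps%:E)%E by rewrite lee_fin ltW.
  exists setT; split => //.
    rewrite probability_setT lee_fin gerBl; by case/andP: d01 => /ltW.
  move=> t _ w; rewrite z; split.
    under eq_integral do rewrite z.
    under eq_bigr do rewrite z.
    by rewrite big1// mulr0 integral0 subee// abse0.
  under eq_integral do rewrite z.
  by rewrite integral0 subee// abse0.
have nR : 0 < n%:R :> R by rewrite ltr0n.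
have r0 : 0 <= eps / 3 by rewrite divr_ge0// ltW.
have v1 d i : \sum_(j < m) vD d i j <= 1.
  apply: le_trans (vsum d i [set: 'I_m]%SET); rewrite le_eqVlt; apply/orP; left.
  by apply/eqP/eq_bigl => j; rewrite inE.
have v0 d i j : 0 <= vD d i j by apply: V0; exact: vV.
have br w d i : exists b, best_response V (g w) (p w) (vD d) (xD d) (yD d) i b.
  have [b bV bmax] := attained w (vD d) (xD d) (yD d) i (vV d).
  by exists b.
pose HP w d := \sum_(i < n) p w (vD d) (xD d) (yD d) i.
pose HR w d := \sum_(i < n) regret V (g w) (p w) (vD d) (xD d) (yD d) i.
have sum_0n (F : 'I_n -> R) : (forall i, 0 <= F i <= 1) ->
    0 <= \sum_(i < n) F i <= n%:R.
  move=> F01; apply/andP; split.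
    by apply: sumr_ge0 => i _; case/andP: (F01 i).
  rewrite -[n in n%:R]card_ord -sumr_const.
  by apply: ler_sum => i _; case/andP: (F01 i).
have HP0n w d : 0 <= HP w d <= n%:R.
  apply: sum_0n => i; apply/andP; split; first exact: p0.
  apply: le_trans (pIR _ _ _ _ (vV d) i) _.
  apply: le_trans (v1 d i); apply: ler_sum => j _.
  by apply: ler_piMl => //; case/andP: (g01 w _ (xD d) (yD d) (vV d) i j).
have HR0n w d : 0 <= HR w d <= n%:R.
  apply: sum_0n => i; have [b bbr] := br w d i.
  rewrite (regret_ge0 (vV d) bbr)/=.
  apply: le_trans (v1 d i); apply: regret_le bbr => //; last exact: pIR.
    by move=> b' b'V; exact: g01.
  by move=> b' b'V; exact: p0.
have [ctrP ctrPP] : exists ctr : 'I_NP -> Om,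
    forall w, exists i, forall d, `|HP (ctr i) d - HP w d| <= eps / 3.
  case: covP => -[c [cF cov]] _.
  (* Centres belong to the class, so each comes from a mechanism and inherits its bounds and
     measurability. *)
  have /choice[ctr ctrE] i : exists w, p w = c i.
    by have [w _ <-] := cF i; exists w.
  exists ctr => w; have [|i ci] := cov (p w); first by exists w.
  exists i => d; rewrite -sumrB (le_trans (ler_norm_sum _ _ _))//.
  rewrite -lee_fin; apply: ltW; apply: le_lt_trans ci.
  apply: ereal_sup_ubound; exists (vD d), (xD d), (yD d); split => //.
  by rewrite -ctrE.
have [ctrU ctrUP] : exists ctr : 'I_NU -> Om,
    forall w, exists i, forall d, `|HR (ctr i) d - HR w d| <= eps / 3.
  case: covU => -[c [cF cov]] _.
  have /choice[ctr ctrE] i : exists w, utility (g w) (p w) = c i.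
    by have [w _ <-] := cF i; exists w.
  exists ctr => w; have [|i ci] := cov (utility (g w) (p w)); first by exists w.
  have uclose v v' x y : in_Vmat V v -> in_Vmat V v' ->
      \sum_(k < n)
        `|utility (g (ctr i)) (p (ctr i)) k (vrow v k)
            (repl_row v k (vrow v' k)) x y
          - utility (g w) (p w) k (vrow v k)
            (repl_row v k (vrow v' k)) x y| <= eps / 6.
    move=> vV' v'V; rewrite -lee_fin; apply: ltW; apply: le_lt_trans ci.
    apply: ereal_sup_ubound; exists v, v', x, y; split => //; split => //.
    by rewrite -ctrE.
  exists i => d; rewrite -sumrB (le_trans (ler_norm_sum _ _ _))//.
  (* One comparison misreport [r k] is chosen for each bidder [k]. *)
  have [r rP] := choice (fun k => let: ex_intro b bP := br (ctr i) d k in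
    let: ex_intro b' b'P := br w d k in
    let: ex_intro2 r rV rle := regret_diff_le bP b'P in
    ex_intro _ r (conj rV rle)).
  (* Row [k] of [v'] only enters through bidder [k]'s own deviation. *)
  pose v' : 'M[R]_(n, m) := \matrix_(k, j) r k j.
  have v'E k : vrow v' k = r k by apply/funext => j; rewrite /vrow mxE.
  have h1 := uclose _ v' (xD d) (yD d) (vV d).
  (* Taking the misreport matrix equal to the true valuations controls the truthful utilities. *)
  have h2 := uclose _ _ (xD d) (yD d) (vV d) (vV d).
  have -> : eps / 3 = eps / 6 + eps / 6 by field.
  apply: le_trans (lerD (h1 _) h2).
    rewrite -big_split/=; apply: ler_sum => k _.
    by rewrite v'E repl_row_id; case: (rP k).
  by move=> k j; rewrite mxE; case: (rP k).
have [GP [mGP QGP GPdev]] := uniform_deviation iid L0 nR r0 mP HP0n ctrPP.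
have [GR [mGR QGR GRdev]] := uniform_deviation iid L0 nR r0 mR HR0n ctrUP.
have eps3 : 3 * (eps / 3) = eps by field.
exists (GP `&` GR); split; first exact: measurableI.
  rewrite -[GP `&` GR]setCK probability_setC; last first.
    (* The complement is measurable too; its probability is then split into [delta / 2] for payments
       and [delta / 2] for regrets. *)
    exact/measurableC/measurableI.
  rewrite EFinB leeB// setCI (le_trans (measureU2 _ _ _))//;
    [exact: measurableC..|].
  have -> : delta = delta / 2 + delta / 2 by field.
  rewrite EFinD leeD//.
    apply: le_trans QGP _; rewrite lee_fin; apply: covering_tail_le heps => //.
    by rewrite le_max lexx.
  apply: le_trans QGR _; rewrite lee_fin; apply: covering_tail_le heps => //.
  by rewrite le_max lexx orbT.
move=> t [/GPdev devP /GRdev devR] w; rewrite eps3 in devP devR; split.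
  exact: devP.
have := devR w; rewrite /HR exchange_big/= mulr_sumr; exact.
Qed.
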